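(* For every $n\in\mathbb{N}$ there exists a constant $k(n)>0$, depending only on $n$, with the following property. Let $\omega$ be a modulus of continuity, let $C\subseteq\mathbb{R}^n$ be a (not necessarily convex) subset, and let $f:C\to\mathbb{R}$ and $G:C\to\mathbb{R}^n$ be given mappings with $G$ not constant. Then there exists a convex function $F\in C^{1,\omega}(\mathbb{R}^n)$ with $F=f$ on $C$ and $\nabla F=G$ on $C$ if and only if $M_*(f,G,C)<\infty$. In this case, $F$ can be taken so that $$\sup_{x,y\in\mathbb{R}^n,\,x\neq y}\frac{|\nabla F(x)-\nabla F(y)|}{\omega(|x-y|)}\ \leq\ k(n)\,M_*(f,G,C),$$ and, further assuming that $0\in C$, also $$\|F\|_{1,\omega}\ \leq\ k(n)\left(|f(0)|+|G(0)|+M_*(f,G,C)\right).$$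
   Context: A modulus of continuity is a concave, strictly increasing function $\omega:[0,\infty)\to[0,\infty)$ with $\omega(0^+)=0$; its inverse is $\omega^{-1}:[0,\beta)\to[0,\infty)$, where $\beta=\sup\omega\in(0,\infty]$. $C^{1,\omega}(\mathbb{R}^n)$ is the set of $C^1$ functions $F:\mathbb{R}^n\to\mathbb{R}$ (not required to be bounded) for which there is $L\geq 0$ with $|\nabla F(x)-\nabla F(y)|\le L\,\omega(|x-y|)$ for all $x,y$. For nonconstant $G$, $M_*(f,G,C)$ denotes the smallest constant $M>0$ such that both $$|G(x)-G(y)|\leq M\omega(|x-y|)\quad\text{and}\quad f(x)-f(y)-\langle G(y),x-y\rangle\geq|G(x)-G(y)|\,\omega^{-1}\!\left(\frac{1}{2M}|G(x)-G(y)|\right)$$ hold for all $x,y\in C$, with $M_*(f,G,C)=\infty$ if no such $M$ exists. For differentiable $F:\mathbb{R}^n\to\mathbb{R}$, $$\|F\|_{1,\omega}=|F(0)|+|\nabla F(0)|+\sup_{x,y\in\mathbb{R}^n,\,x\neq y}\frac{|\nabla F(x)-\nabla F(y)|}{\omega(|x-y|)}.$$ *)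

(* Defs.v *)
From HB Require Import structures.
From mathcomp Require Import all_boot all_order all_algebra.
From mathcomp Require Import all_classical all_reals all_analysis.

Set Implicit Arguments.
Unset Strict Implicit.
Unset Printing Implicit Defensive.

Import Order.TTheory GRing.Theory Num.Theory.
From mathcomp Require Import lra.
Import numFieldNormedType.Exports.

Local Open Scope classical_set_scope.
Local Open Scope ring_scope.

Section definitions.
Context {R : realType}.
Implicit Types (w : R -> R).

(* A function on [0, oo) is a function on R of which only the values on
   [0, oo) are used. *)
Definition modulus_of_continuity w :=
  [/\ {in `[0, +oo[, forall t, 0 <= w t},
      convex_function (`[0, +oo[ : set (convex_lmodType R^o))
        (fun t => - w t : R^o),
      {in `[0, +oo[ &, {homo w : s t / s < t}} &
      w t @[t --> 0^'+] --> (0 : R)].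

(* The value is 0 (a dummy) outside of the range [0, sup w) of w. *)
Definition modulus_inv w : R -> R := 'pinv_(fun=> 0) `[0, +oo[%classic w.

Variable n : nat.
Implicit Types (F f : 'rV[R]_n -> R) (G : 'rV[R]_n -> 'rV[R]_n).
Implicit Types (C : set 'rV[R]_n) (x y u v : 'rV[R]_n).

Definition inner u v : R := \sum_(i < n) u ord0 i * v ord0 i.

(* The Euclidean norm; `|u| is the sup norm of u. *)
Definition enorm u : R := Num.sqrt (inner u u).

Definition grad F x : 'rV[R]_n := \row_i 'D_(delta_mx ord0 i) F x.

Definition convex_on_space F :=
  convex_function (setT : set (convex_lmodType 'rV[R]_n)) F.

Definition C1 F :=
  (forall x, differentiable F x) /\ continuous (grad F).

Definition C1w w F :=
  C1 F /\
  exists2 L : R, 0 <= L &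
    forall x y, enorm (grad F x - grad F y) <= L * w (enorm (x - y)).

Definition grad_seminorm w F : \bar R :=
  ereal_sup [set e | exists x y, x <> y /\
    e = (enorm (grad F x - grad F y) / w (enorm (x - y)))%:E].

Definition norm1w w F : \bar R :=
  ((`|F 0|)%:E + (enorm (grad F 0))%:E + grad_seminorm w F)%E.

Definition nonconstant_on C G := exists x y, [/\ C x, C y & G x <> G y].

(* By the first inequality, the argument of modulus_inv w in the second one is
   at most w (enorm (x - y)) / 2, hence is in the range of w. *)
Definition admissible w f G C (M : R) :=
  [/\ 0 < M,
      (forall x y, C x -> C y -> enorm (G x - G y) <= M * w (enorm (x - y))) &
      (forall x y, C x -> C y ->
        f x - f y - inner (G y) (x - y) >=
        enorm (G x - G y) *
          modulus_inv w ((2 * M)^-1 * enorm (G x - G y)))].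

(* The infimum is +oo if no constant is admissible; otherwise it is a minimum
   when G is not constant on C, see Mstar_min. *)
Definition Mstar w f G C : \bar R :=
  ereal_inf [set M%:E | M in [set M | admissible w f G C M]].

End definitions.

Section smallest_constant.
Context {R : realType}.

Lemma enorm_gt0 n (u : 'rV[R]_n) : u != 0 -> 0 < enorm u.
Proof.
move=> u0; rewrite sqrtr_gt0 lt_neqAle eq_sym.
have sq_ge0 i : true -> 0 <= u ord0 i * u ord0 i.
  by move=> _; rewrite -expr2 sqr_ge0.
rewrite sumr_ge0// andbT; apply: contra u0 => /eqP/psumr_eq0P h.
apply/eqP/rowP => i; rewrite mxE; apply/eqP.
by have /eqP := h sq_ge0 i isT; rewrite mulf_eq0 orbb.
Qed.

Variable w : R -> R.
Hypothesis hw : modulus_of_continuity w.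

Lemma modulus_lt s t : 0 <= s -> s < t -> w s < w t.
Proof.
move=> s0 st; case: hw => _ _ incr _.
by apply: incr; rewrite // in_itv/= ?s0// (le_trans s0 (ltW st)).
Qed.

Lemma modulus_le s t : 0 <= s -> s <= t -> w s <= w t.
Proof.
by move=> s0; rewrite le_eqVlt => /predU1P[->//|/(modulus_lt s0)/ltW].
Qed.

Lemma modulus_ge0 t : 0 <= t -> 0 <= w t.
Proof. by move=> t0; case: hw => ge0 _ _ _; rewrite ge0// in_itv/= t0. Qed.

Lemma modulus_small e : 0 < e ->
  exists2 d, 0 < d & forall t, 0 < t -> t < d -> w t < e.
Proof.
move=> e0; case: hw => _ _ _ /cvgrPdist_lt/(_ e e0).
rewrite /at_right near_withinE => -[d /= d0 hd].
exists d => // t t0 td.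
have dt : ball_ Num.norm 0 d t by rewrite /ball_/= sub0r normrN gtr0_norm.
by apply: le_lt_trans (hd t dt t0); rewrite sub0r normrN ler_norm.
Qed.

Lemma modulus0 : w 0 = 0.
Proof.
apply/eqP; rewrite eq_le modulus_ge0// andbT leNgt; apply/negP => w0.
have [d d0 /(_ (d / 2))] := modulus_small w0.
have d20 : 0 < d / 2 by rewrite divr_gt0.
have d2d : d / 2 < d by rewrite ltr_pdivrMr// ltr_pMr// ltr1n.
by move=> /(_ d20 d2d); rewrite ltNge modulus_le// ltW.
Qed.

Lemma modulus_scale h t : 0 <= h -> h <= 1 -> 0 <= t -> h * w t <= w (h * t).
Proof.
move=> h0 h1 t0; case: hw => _ cvx _ _.
have := cvx (Itv01 h0 h1) t 0.
rewrite !inE/= !in_itv/= t0 lexx => /(_ isT isT).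
rewrite !convRE /conv/= modulus0 oppr0 mulr0 addr0.
by rewrite scaler0 addr0 mulrN lerN2.
Qed.

Lemma modulus_surj b v : 0 <= b -> 0 <= v -> v <= w b ->
  exists2 t, 0 <= t & w t = v.
Proof.
move=> b0 v0 vb.
pose S := [set s : R | [/\ 0 <= s, s <= b & w s <= v]].
have S0 : S 0 by split => //; rewrite modulus0.
have Sb : ubound S b by move=> s [].
have supS : has_sup S by split; [exists 0|exists b].
pose t := sup S; have t0 : 0 <= t by apply: ub_le_sup => //; exists b.
have tb : t <= b by apply: ge_sup => //; exists 0.
exists t => //; apply/eqP; rewrite eq_le; apply/andP; split.
  rewrite leNgt; apply/negP => vt.
  have wt0 : 0 < w t by apply: le_lt_trans vt.
  have tpos : 0 < t.
    rewrite lt_neqAle t0 andbT; apply/eqP => t_eq0.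
    by move: wt0; rewrite -t_eq0 modulus0 ltxx.
  pose h := (v / w t + 1) / 2.
  have vw1 : v / w t < 1 by rewrite ltr_pdivrMr// mul1r.
  have vw0 : 0 <= v / w t by rewrite divr_ge0// ltW.
  have h0 : 0 <= h by rewrite /h; lra.
  have h1 : h < 1 by rewrite /h; lra.
  have hv : v < h * w t by rewrite -ltr_pdivrMr// /h; lra.
  have [|s [s0 _ wsv] hts] := @sup_adherent _ S (t - h * t) _ supS.
    by rewrite subr_gt0 gtr_pMl.
  have := modulus_scale h0 (ltW h1) t0.
  rewrite leNgt => /negP; apply.
  apply: le_lt_trans hv; apply: le_trans wsv; apply: modulus_le.
    exact: mulr_ge0.
  by apply: ltW; move: hts; rewrite -/t opprB addrCA subrr addr0.
rewrite leNgt; apply/negP => wtv.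
have ltb : t < b.
  rewrite lt_neqAle tb andbT; apply/eqP => t_eqb.
  by move: wtv; rewrite t_eqb ltNge vb.
suff [s ts [sb sv]] : exists2 s, t < s & s <= b /\ w s <= v.
  have Ss : S s by split => //; rewrite ltW// (le_lt_trans t0).
  by have := ub_le_sup (ex_intro _ b Sb) Ss; rewrite leNgt ts.
have [t_eq0|tpos] := leP t 0.
  have {t_eq0}t_eq0 : t = 0 by apply/eqP; rewrite eq_le t_eq0.
  rewrite t_eq0 modulus0 in wtv ltb *.
  have [d d0 hd] := modulus_small wtv.
  pose s := Num.min (d / 2) b.
  have s0 : 0 < s by rewrite lt_min ltb divr_gt0.
  exists s => //; split; first by rewrite ge_min lexx orbT.
  apply/ltW/hd => //; rewrite gt_min; apply/orP; left.
  by rewrite ltr_pdivrMr// ltr_pMr// ltr1n.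
have vpos : 0 < v by apply: le_lt_trans wtv; exact: modulus_ge0.
pose h := Num.max (w t / v) (t / b).
have bpos : 0 < b by apply: lt_trans ltb.
have wtpos : 0 < w t by rewrite -modulus0; apply: modulus_lt.
have h0 : 0 < h by rewrite lt_max divr_gt0.
have h1 : h < 1 by rewrite gt_max !ltr_pdivrMr// !mul1r wtv ltb.
exists (t / h).
  by rewrite ltr_pdivlMr// gtr_pMr.
split.
  by rewrite ler_pdivrMr// mulrC -ler_pdivrMr// le_max lexx orbT.
have th0 : 0 <= t / h by rewrite divr_ge0// ltW.
have := modulus_scale (ltW h0) (ltW h1) th0.
rewrite mulrCA divff ?gt_eqF// mulr1 mulrC -ler_pdivlMr// => /le_trans; apply.
by rewrite ler_pdivrMr// mulrC -ler_pdivrMr// le_max lexx.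
Qed.

Lemma modulus_invK t : 0 <= t -> modulus_inv w (w t) = t.
Proof.
move=> t0; apply: pinvKV; last by rewrite inE/= in_itv/= t0.
move=> x y; rewrite !inE/= !in_itv/= !andbT => x0 y0 wxy.
have [xy|yx|//] := ltgtP x y.
  by have := modulus_lt x0 xy; rewrite wxy ltxx.
by have := modulus_lt y0 yx; rewrite wxy ltxx.
Qed.

Lemma Mstar_min n (f : 'rV[R]_n -> R) G C : nonconstant_on C G ->
  (Mstar w f G C < +oo)%E ->
  exists M, [/\ Mstar w f G C = M%:E, admissible w f G C M &
    forall M', admissible w f G C M' -> M <= M'].
Proof.
move=> [x0 [y0 [Cx0 Cy0 Gxy]]] Mfin.
pose a0 := enorm (G x0 - G y0); pose w0 := w (enorm (x0 - y0)).
have a0pos : 0 < a0 by apply: enorm_gt0; rewrite subr_eq0; apply/eqP.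
have adm_lb M : admissible w f G C M -> 0 < w0 /\ a0 / w0 <= M.
  move=> [M0 /(_ _ _ Cx0 Cy0) h _].
  have w0pos : 0 < w0.
    by rewrite -(pmulr_rgt0 _ M0); apply: lt_le_trans h.
  by rewrite ler_pdivrMr.
have Mlb : ((a0 / w0)%:E <= Mstar w f G C)%E.
  by apply: le_ereal_inf_tmp => _ [M /adm_lb[_ h] <-]; rewrite lee_fin.
have Mfn : Mstar w f G C \is a fin_num.
  by rewrite fin_numE -ltNye -ltey Mfin (lt_le_trans _ Mlb)// ltNyr.
pose m := fine (Mstar w f G C).
have mE : Mstar w f G C = m%:E by rewrite fineK.
have mle M : admissible w f G C M -> m <= M.
  by move=> aM; rewrite -lee_fin -mE; apply: ereal_inf_lbound; exists M.
have approx e : 0 < e -> exists2 M, admissible w f G C M & M < m + e.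
  move=> e0; have [_ [M aM <-]] := lb_ereal_inf_adherent e0 Mfn.
  by rewrite -/(Mstar _ _ _ _) mE -EFinD lte_fin; exists M.
have [M1 aM1 _] := approx 1 ltr01.
have mpos : 0 < m.
  have [w0pos _] := adm_lb _ aM1.
  apply: (@lt_le_trans _ _ (a0 / w0)); first exact: divr_gt0.
  by rewrite -lee_fin -mE.
have lip x y : C x -> C y -> enorm (G x - G y) <= m * w (enorm (x - y)).
  move=> Cx Cy; apply/ler_addgt0Pr => e e0.
  set W := w _; have W0 : 0 <= W by apply/modulus_ge0/sqrtr_ge0.
  have W1 : 0 < W + 1 by lra.
  have [M [_ /(_ _ _ Cx Cy) h _] Me] := approx _ (divr_gt0 e0 W1).
  apply: le_trans h _; rewrite -/W.
  apply: (@le_trans _ _ ((m + e / (W + 1)) * W)).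
    by rewrite ler_wpM2r// ltW.
  rewrite mulrDl lerD2l mulrAC ler_pdivrMr// ler_pM2l//; lra.
exists m; split => //; split => // x y Cx Cy.
have [_ _ /(_ _ _ Cx Cy)] := aM1.
set a := enorm _; set D := f x - f y - _ => hD1.
have a_ge0 : 0 <= a by apply: sqrtr_ge0.
have [a_eq0|a_neq0] := eqVneq a 0; first by rewrite a_eq0 !mul0r in hD1 *.
have apos : 0 < a by rewrite lt_neqAle eq_sym a_neq0.
have d_ge0 : 0 <= enorm (x - y) by apply: sqrtr_ge0.
pose v M := (2 * M)^-1 * a.
have v_surj M : m <= M -> exists2 t, 0 <= t & w t = v M.
  move=> mM; have M0 : 0 < M by apply: lt_le_trans mM.
  have M20 : 0 < 2 * M by apply: mulr_gt0.
  apply: (modulus_surj d_ge0); first by rewrite mulr_ge0// invr_ge0 ltW.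
  rewrite /v mulrC ler_pdivrMr// mulrC (le_trans (lip x y Cx Cy))//.
  by rewrite ler_wpM2r ?modulus_ge0//; lra.
have [t t0 wt] := v_surj m (lexx m).
rewrite -/(v m) -wt modulus_invK//.
have lower s : 0 <= s -> s < t -> a * s <= D.
  move=> s0 st; have := modulus_lt s0 st; rewrite wt => wsv.
  have ws0 := modulus_ge0 s0; have ws1 : 0 < 2 * (w s + 1) by lra.
  have gap : 0 < a - 2 * m * w s.
    by rewrite subr_gt0 mulrC -ltr_pdivlMr ?mulr_gt0// mulrC.
  have [M aM Mlt] := approx _ (divr_gt0 gap ws1).
  have mM := mle _ aM; have M0 : 0 < M by apply: lt_le_trans mM.
  have [_ _ /(_ _ _ Cx Cy)] := aM; rewrite -/a -/D -/(v M).
  have [r r0 wr] := v_surj M mM.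
  rewrite -wr modulus_invK//; apply: le_trans.
  rewrite ler_pM2l// leNgt; apply/negP => rs.
  have := modulus_lt r0 rs; rewrite wr /v mulrC ltr_pdivrMr ?mulr_gt0//.
  move: Mlt; rewrite -ltrBlDl ltr_pdivlMr// => Mlt aws.
  have := ler_wpM2r ws0 mM; nra.
have [t_eq0|tpos] := eqVneq t 0.
  have [_ _ /(_ _ _ Cx Cy)] := aM1; rewrite -/a -/D.
  rewrite t_eq0 modulus0 in wt; have : 0 < v m.
    by rewrite mulr_gt0// invr_gt0 mulr_gt0.
  by rewrite -wt ltxx.
have {}tpos : 0 < t by rewrite lt_neqAle eq_sym tpos.
rewrite leNgt; apply/negP => Dlt.
pose s := Num.max 0 (D / a).
have st : s < t by rewrite gt_max tpos ltr_pdivrMr// mulrC.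
have s0 : 0 <= s by rewrite le_max lexx.
have Ds : D <= a * s.
  by rewrite mulrC -ler_pdivrMr// le_max lexx orbT.
have := lower ((s + t) / 2); nra.
Qed.

End smallest_constant.

(* Main.v *)
(** The extension is the largest convex function [F] below all the functions
[g_y x = f y + <G y, x - y> + 2 M |x - y| w |x - y|] with [y] in [C]. The
condition on [f] and [G] says, through Young's inequality for [w] and its
inverse, that the tangent plane at each point of [C] lies below every [g_y]; so
[F] is squeezed between the tangent plane and [g_y] at [y], and has the
prescribed 1-jet there. Concavity of [w] and the parallelogram law bound the
second differences of [u |-> |u| w |u|] by [6 |v| w |v|]. This bound passes to
[F] by maximality, because the average of two opposite translates of a convex
minorant, lowered by a constant, is again a convex minorant. A convex function
whose second differences are at most [A |v| w |v|] is differentiable, and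
comparing it with its tangent planes shows that its gradient has modulus
[4 A w]. With [A = 12 M] this gives the constant 48 in every dimension.

[|u| w |u|] plays the role of the primitive of [w] usually taken here: it need
not be convex, and no integral is needed. *)

From HB Require Import structures.
Require Import Defs.
From mathcomp Require Import all_boot all_order all_algebra.
From mathcomp Require Import all_classical all_reals all_analysis.
From mathcomp Require Import ring lra.
Import Order.TTheory GRing.Theory Num.Theory.
Import numFieldNormedType.Exports.

Set Implicit Arguments.
Unset Strict Implicit.
Unset Printing Implicit Defensive.

Local Open Scope classical_set_scope.
Local Open Scope ring_scope.

(** * Euclidean norm and its comparison with the sup norm *)

Section euclid.
Context {R : realType} {n : nat}.
Implicit Types (u v x : 'rV[R]_n) (a : R).

Lemma innerC u v : inner u v = inner v u.
Proof. by apply: eq_bigr => i _; rewrite mulrC. Qed.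

Lemma innerDr u v x : inner u (v + x) = inner u v + inner u x.
Proof. by rewrite -big_split; apply: eq_bigr => i _; rewrite mxE mulrDr. Qed.

Lemma innerZr a u v : inner u (a *: v) = a * inner u v.
Proof. by rewrite mulr_sumr; apply: eq_bigr => i _; rewrite mxE mulrCA. Qed.

Lemma innerNr u v : inner u (- v) = - inner u v.
Proof. by rewrite -scaleN1r innerZr mulN1r. Qed.

Lemma innerDl u v x : inner (u + v) x = inner u x + inner v x.
Proof. by rewrite !(innerC _ x) innerDr. Qed.

Lemma innerZl a u v : inner (a *: u) v = a * inner u v.
Proof. by rewrite !(innerC _ v) innerZr. Qed.

Lemma innerNl u v : inner (- u) v = - inner u v.
Proof. by rewrite !(innerC _ v) innerNr. Qed.

Lemma inner0l u : inner 0 u = 0.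
Proof. by rewrite -(scale0r 0) innerZl mul0r. Qed.

Definition innerE := (innerDl, innerDr, innerNl, innerNr, innerZl, innerZr).

Lemma inner_ge0 u : 0 <= inner u u.
Proof. by apply: sumr_ge0 => i _; rewrite -expr2 sqr_ge0. Qed.

Lemma enorm_ge0 u : 0 <= enorm u.
Proof. exact: sqrtr_ge0. Qed.

Lemma enorm_sqr u : enorm u ^+ 2 = inner u u.
Proof. by rewrite sqr_sqrtr ?inner_ge0. Qed.

Lemma enorm0 : enorm (0 : 'rV[R]_n) = 0.
Proof. by rewrite /enorm inner0l sqrtr0. Qed.

Lemma enormZ a u : enorm (a *: u) = `|a| * enorm u.
Proof.
by rewrite /enorm !innerE mulrA -expr2 sqrtrM ?sqr_ge0// sqrtr_sqr.
Qed.

Lemma enormN u : enorm (- u) = enorm u.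
Proof. by rewrite -scaleN1r enormZ normrN1 mul1r. Qed.

Lemma enormB u v : enorm (u - v) = enorm (v - u).
Proof. by rewrite -enormN opprB. Qed.

Lemma cauchy_schwarz u v : inner u v <= enorm u * enorm v.
Proof.
have [->|u0] := eqVneq u 0; first by rewrite inner0l enorm0 mul0r.
have [->|v0] := eqVneq v 0; first by rewrite innerC inner0l enorm0 mulr0.
have uv0 : 0 < enorm u * enorm v by rewrite mulr_gt0 ?enorm_gt0.
rewrite -(ler_pM2l uv0).
have := inner_ge0 (enorm v *: u - enorm u *: v).
rewrite !innerE -!enorm_sqr (innerC v u); nra.
Qed.

Lemma enormD u v : enorm (u + v) <= enorm u + enorm v.
Proof.
rewrite -(ler_pXn2r (isT : 0 < 2)%N) ?nnegrE ?addr_ge0 ?enorm_ge0//.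
have := cauchy_schwarz u v.
by rewrite enorm_sqr !innerE sqrrD -!enorm_sqr (innerC v u); lra.
Qed.

Lemma parallelogram u v :
  enorm (u + v) ^+ 2 + enorm (u - v) ^+ 2 = 2 * (enorm u ^+ 2 + enorm v ^+ 2).
Proof. by rewrite !enorm_sqr !innerE; ring. Qed.

Lemma norm_le_enorm u : `|u| <= enorm u.
Proof.
rewrite [leLHS]/Num.norm/= mx_normrE; apply/bigmax_leP; split => [|[i j] _ /=].
  exact: enorm_ge0.
rewrite (ord1 i) -sqrtr_sqr ler_wsqrtr// expr2 /inner (bigD1 j)//= lerDl.
by apply: sumr_ge0 => k _; rewrite -expr2 sqr_ge0.
Qed.

Lemma coord_le_norm u i : `|u ord0 i| <= `|u|.
Proof.
rewrite [leRHS]/Num.norm/= mx_normrE.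
by apply: (le_bigmax _ (fun ij => `|u ij.1 ij.2|) (ord0, i)).
Qed.

Lemma enorm_le_norm u : enorm u <= n.+1%:R * `|u|.
Proof.
rewrite -(ler_pXn2r (isT : 0 < 2)%N) ?nnegrE ?mulr_ge0 ?enorm_ge0//.
rewrite enorm_sqr exprMn; apply: (@le_trans _ _ (n%:R * `|u| ^+ 2)).
  have -> : n%:R * `|u| ^+ 2 = \sum_(i < n) `|u| ^+ 2.
    by rewrite sumr_const card_ord mulr_natl.
  apply: ler_sum => i _; rewrite -expr2 -real_normK ?num_real//.
  by rewrite lerXn2r ?nnegrE// coord_le_norm.
rewrite ler_wpM2r ?sqr_ge0// -natrX ler_nat.
by rewrite (leq_trans (leqnSn n))// leq_pmulr.
Qed.

(** Neighbourhoods are those of the sup norm; this lets epsilon-delta arguments run with [enorm]. *)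
Lemma nbhs_enorm x (P : set 'rV[R]_n) d : 0 < d ->
  (forall y, enorm (x - y) < d -> P y) -> nbhs x P.
Proof.
move=> d0 hP; apply/nbhs_ballP; exists (d / n.+1%:R) => /=.
  by rewrite divr_gt0.
move=> y; rewrite mx_norm_ball /ball_/= => xy; apply: hP.
by apply: le_lt_trans (enorm_le_norm _) _; rewrite mulrC -ltr_pdivlMr.
Qed.

Lemma inner_continuous u : continuous (inner u : 'rV[R]_n -> R).
Proof.
move=> x; apply/(@cvgrPdist_lt _ _ _ (nbhs x)) => e e0.
have c0 : 0 < enorm u + 1 by rewrite ltr_wpDl ?enorm_ge0.
apply: (@nbhs_enorm _ _ (e / (enorm u + 1))); first exact: divr_gt0.
move=> y; rewrite ltr_pdivlMr// => xy; rewrite -innerNr -innerDr.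
apply: le_lt_trans xy; rewrite mulrC.
apply: (@le_trans _ _ (enorm u * enorm (x - y))).
  rewrite ler_norml cauchy_schwarz andbT lerNl -innerNr.
  by rewrite -(enormN (x - y)) cauchy_schwarz.
by rewrite ler_wpM2r ?enorm_ge0// lerDl.
Qed.

End euclid.

(** * Concavity estimates for the modulus *)

Section modulus.
Context {R : realType}.
Variable w : R -> R.
Hypothesis hw : modulus_of_continuity w.

Lemma modulus_dilate c t : 1 <= c -> 0 <= t -> w (c * t) <= c * w t.
Proof.
move=> c1 t0; have c0 : 0 < c by apply: lt_le_trans c1.
have ci : 0 <= c^-1 by rewrite invr_ge0 ltW.
have ci1 : c^-1 <= 1 by rewrite invf_le1.
have := modulus_scale hw ci ci1 (mulr_ge0 (ltW c0) t0).
by rewrite mulKf ?gt_eqF// mulrC ler_pdivrMr// [w t * c]mulrC.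
Qed.

(** Concavity with weights proportional to [p] and [q] themselves, which turns a sum of terms
    [r w r] into one value of [w]. *)
Lemma modulus_jensen p q : 0 <= p -> 0 <= q -> 0 < p + q ->
  p * w p + q * w q <= (p + q) * w ((p ^+ 2 + q ^+ 2) / (p + q)).
Proof.
move=> p0 q0 pq0.
have h0 : 0 <= p / (p + q) by rewrite divr_ge0// ltW.
have h1 : p / (p + q) <= 1 by rewrite ler_pdivrMr// mul1r lerDl.
case: hw => _ cvx _ _; have := cvx (Itv01 h0 h1) p q.
rewrite !inE/= !in_itv/= p0 q0 => /(_ isT isT).
rewrite !convRE /conv/= /unstable.onem.
have -> : 1 - p / (p + q) = q / (p + q) by field; rewrite gt_eqF.
set a := p / (p + q); set b := q / (p + q).
have -> : a *: (p : R^o) + b *: (q : R^o) = (p ^+ 2 + q ^+ 2) / (p + q) :> R.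
  by rewrite /GRing.scale/= /a /b; field; rewrite gt_eqF.
rewrite !mulrN -opprD lerN2 -(ler_pM2l pq0) => /(le_trans _); apply.
rewrite le_eqVlt; apply/orP; left; apply/eqP; rewrite /a /b; field.
by rewrite gt_eqF.
Qed.

(* [p] and [q] are the lengths of the diagonals of a parallelogram with sides
   [t] and [h]. *)
Lemma modulus_diagonals t h p q :
  0 <= t -> 0 <= h -> 0 <= p -> 0 <= q ->
  p ^+ 2 + q ^+ 2 = 2 * (t ^+ 2 + h ^+ 2) -> 2 * t <= p + q ->
  p * w p + q * w q <= 2 * (t * w t) + 6 * (h * w h).
Proof.
move=> t0 h0 p0 q0 pqE tpq.
have wt0 := modulus_ge0 hw t0; have wh0 := modulus_ge0 hw h0.
(* If [t < h], both diagonals are at most [2 h] and their sum is at most [2 sqrt 2 h <= 3 h]; this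
   case produces the constant 6. *)
have [ht|th] := leP h t; last first.
  have hpos : 0 < h by apply: le_lt_trans th.
  have w2h : w (2 * h) <= 2 * w h by apply: modulus_dilate => //; lra.
  have le2h r : 0 <= r -> r ^+ 2 <= 4 * h ^+ 2 -> w r <= 2 * w h.
    by move=> r0 rh; apply: le_trans w2h; apply: modulus_le => //; nra.
  have wp : w p <= 2 * w h by apply: le2h => //; nra.
  have wq : w q <= 2 * w h by apply: le2h => //; nra.
  have pq3 : p + q <= 3 * h.
    rewrite -(ler_pXn2r (isT : 0 < 2)%N) ?nnegrE ?addr_ge0//; last by lra.
    have := sqr_ge0 (p - q); nra.
  have := ler_wpM2l p0 wp; have := ler_wpM2l q0 wq.
  have := ler_wpM2r wh0 pq3; have := mulr_ge0 t0 wt0; lra.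
have [t_eq0|tneq0] := eqVneq t 0.
  have h_eq0 : h = 0 by apply/eqP; rewrite eq_le h0 andbT -t_eq0.
  have p_eq0 : p = 0 by nra.
  have q_eq0 : q = 0 by nra.
  by rewrite t_eq0 h_eq0 p_eq0 q_eq0; lra.
have tpos : 0 < t by rewrite lt_neqAle eq_sym tneq0.
have pqpos : 0 < p + q by lra.
(* For [h <= t], the diagonals sum to at most [(2 + e) t] and their weighted mean is at most
   [(1 + e) t]. Then [(2 + e) (1 + e) <= 2 + 4 e], while concavity gives [e t w t <= h w h]. *)
pose e := (h / t) ^+ 2.
have e0 : 0 <= e by apply: sqr_ge0.
have e1 : e <= 1.
  by rewrite /e expr_le1 ?divr_ge0// ler_pdivrMr// mul1r.
have eE : h ^+ 2 = e * t ^+ 2 by rewrite /e; field.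
have P2 : p + q <= t * (2 + e).
  rewrite -(ler_pXn2r (isT : 0 < 2)%N) ?nnegrE ?addr_ge0//; last first.
    by rewrite mulr_ge0// addr_ge0.
  have : (t * (2 + e)) ^+ 2 = 4 * (t ^+ 2 + h ^+ 2) + (t * e) ^+ 2.
    by rewrite eE; ring.
  have := sqr_ge0 (p - q); have := sqr_ge0 (t * e).
  by rewrite !expr2 in pqE *; lra.
apply: le_trans (modulus_jensen p0 q0 pqpos) _.
have mean : (p ^+ 2 + q ^+ 2) / (p + q) <= (1 + e) * t.
  rewrite ler_pdivrMr// pqE eE.
  have := ler_wpM2l (mulr_ge0 (addr_ge0 ler01 e0) t0) tpq; rewrite expr2; lra.
have wm : w ((p ^+ 2 + q ^+ 2) / (p + q)) <= (1 + e) * w t.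
  apply: le_trans (modulus_dilate _ t0); last by lra.
  by apply: modulus_le mean => //; rewrite divr_ge0 ?addr_ge0 ?sqr_ge0.
apply: (@le_trans _ _ (t * (2 + e) * ((1 + e) * w t))).
  apply: ler_pM => //; first by rewrite addr_ge0.
  by rewrite modulus_ge0// divr_ge0 ?addr_ge0 ?sqr_ge0.
have ewt : e * (t * w t) <= h * w h.
  have h1 : h / t <= 1 by rewrite ler_pdivrMr// mul1r.
  have := modulus_scale hw (divr_ge0 h0 t0) h1 t0.
  rewrite divfK// => /(ler_wpM2l h0); apply: le_trans.
  by rewrite le_eqVlt; apply/orP; left; apply/eqP; rewrite /e; field.
have := mulr_ge0 h0 wh0; have := mulr_ge0 t0 wt0.
have := ler_wpM2r (mulr_ge0 t0 wt0) (ler_wpM2l e0 e1); lra.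
Qed.

Lemma radial_second_difference n (u v : 'rV[R]_n) :
  enorm (u + v) * w (enorm (u + v)) + enorm (u - v) * w (enorm (u - v)) <=
  2 * (enorm u * w (enorm u)) + 6 * (enorm v * w (enorm v)).
Proof.
apply: modulus_diagonals; rewrite ?enorm_ge0//; first exact: parallelogram.
have := enormD (u + v) (u - v).
by rewrite addrCA addrK -mulr2n -scaler_nat enormZ ger0_norm.
Qed.

End modulus.

(** * One-sided slopes of convex functions *)

Section convex.
Context {R : realType} {n : nat}.
Implicit Types (F : 'rV[R]_n -> R) (x y z u v p : 'rV[R]_n).

Lemma convex_on_spaceP F : convex_on_space F <->
  forall a x y, 0 <= a -> a <= 1 ->
    F (a *: x + (1 - a) *: y) <= a * F x + (1 - a) * F y.
Proof.
split=> [cF a x y a0 a1|cF a x y _ _].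
  have := cF (Itv01 a0 a1) x y.
  by rewrite !inE => /(_ Logic.I Logic.I); rewrite convRE.
rewrite convRE; exact: cF.
Qed.

(** Unnormalised weights and cleared denominators suit the comparison of difference quotients. *)
Lemma convex_combination F (a b : R) x y z : convex_on_space F ->
  0 <= a -> 0 <= b -> 0 < a + b -> (a + b) *: z = a *: x + b *: y ->
  (a + b) * F z <= a * F x + b * F y.
Proof.
move=> /convex_on_spaceP cF a0 b0 ab0 zE.
have ab_neq0 : a + b != 0 by rewrite gt_eqF.
pose c := a / (a + b).
have bE : 1 - c = b / (a + b) by rewrite /c; field.
have -> : z = c *: x + (1 - c) *: y.
  apply: (scalerI ab_neq0).
  by rewrite zE bE scalerDr !scalerA /c !(mulrC (a + b)) !divfK.
have c0 : 0 <= c by rewrite /c divr_ge0// ltW.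
have c1 : c <= 1 by rewrite /c ler_pdivrMr// mul1r lerDl.
have := ler_wpM2l (ltW ab0) (cF c x y c0 c1); rewrite bE => /le_trans; apply.
by rewrite le_eqVlt; apply/orP; left; apply/eqP; rewrite /c; field.
Qed.

Lemma convex_midpoint F x y z : convex_on_space F ->
  2 *: z = x + y -> 2 * F z <= F x + F y.
Proof.
move=> cF zE.
have := @convex_combination F 1 1 x y z cF ler01 ler01 (addr_gt0 ltr01 ltr01).
by rewrite !scale1r !mul1r; apply.
Qed.

Section slope.
Variables (F : 'rV[R]_n -> R) (x : 'rV[R]_n).
Hypothesis cF : convex_on_space F.

Let quotient v t := (F (x + t *: v) - F x) / t.

Let quotients v := [set quotient v t | t in [set t | 0 < t]].

(** The quotients of a convex function increase with the step, so this infimum is the one-sided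
    directional derivative at [x] along [v]. *)
Definition directional_slope v := inf (quotients v).

Let D := directional_slope.

(** [x] lies between [x - v] and [x + t v]. The bound is independent of [t], so the infimum is a
    genuine one. *)
Let quotient_ge v t : 0 < t -> F x - F (x - v) <= quotient v t.
Proof.
move=> t0; rewrite ler_pdivlMr//.
have := @convex_combination F 1 t (x + t *: v) (x - v) x cF ler01 (ltW t0).
rewrite addr_gt0// => /(_ isT); rewrite scale1r scalerDl scale1r scalerBr.
by rewrite addrACA subrr addr0 => /(_ erefl); lra.
Qed.

Let quotients_lbound v : has_lbound (quotients v).
Proof. by exists (F x - F (x - v)) => _ [t /= t0 <-]; exact: quotient_ge. Qed.

Let quotients_neq0 v : quotients v !=set0.
Proof. by exists (quotient v 1), 1 => /=. Qed.

Let slope_le v t : 0 < t -> D v <= quotient v t.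
Proof. by move=> t0; apply: ge_inf => //; exists t. Qed.

Let slope_ge v c : (forall t, 0 < t -> c <= quotient v t) -> c <= D v.
Proof. by move=> h; apply: lb_le_inf => // _ [t /= t0 <-]; exact: h. Qed.

Let quotient_homo v s t : 0 < s -> s <= t -> quotient v s <= quotient v t.
Proof.
move=> s0 st; have t0 : 0 < t by apply: lt_le_trans st.
rewrite ler_pdivrMr// mulrAC ler_pdivlMr//.
have st0 : 0 <= t - s by rewrite subr_ge0.
have := @convex_combination F s (t - s) (x + t *: v) x (x + s *: v) cF
  (ltW s0) st0.
rewrite (addrC s) subrK => /(_ t0) h; suff : t * F (x + s *: v) <=
  s * F (x + t *: v) + (t - s) * F x by nra.
apply: h; rewrite !scalerDr !scalerA [t * s]mulrC addrAC -scalerDl.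
by rewrite (addrC s) subrK.
Qed.

Let slopeD u v : D (u + v) <= D u + D v.
Proof.
rewrite -lerBlDl; apply: slope_ge => t t0.
rewrite lerBlDl -lerBlDr; apply: slope_ge => s s0.
rewrite lerBlDr; pose r := Num.min s t.
have r0 : 0 < r by rewrite lt_min s0.
have r20 : 0 < r / 2 by rewrite divr_gt0.
apply: le_trans (slope_le _ r20) _.
apply: (@le_trans _ _ (quotient u r + quotient v r)); last first.
  by rewrite lerD// quotient_homo// ge_min lexx ?orbT.
rewrite /quotient -mulrDl ler_pdivrMr// mulrAC ler_pdivlMr//.
have h : 2 * F (x + (r / 2) *: (u + v)) <= F (x + r *: u) + F (x + r *: v).
  apply: convex_midpoint => //.
  rewrite scalerDr scalerA [2 * _]mulrC divfK ?pnatr_eq0//.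
  by rewrite addrACA -mulr2n scaler_nat scalerDr.
have := ler_wpM2l (ltW r20) h; lra.
Qed.

Let slopeZ_le a v : 0 < a -> D (a *: v) <= a * D v.
Proof.
move=> a0; rewrite mulrC -ler_pdivrMr//; apply: slope_ge => t t0.
have ta0 : 0 < t / a by rewrite divr_gt0.
rewrite ler_pdivrMr//; apply: le_trans (slope_le _ ta0) _.
rewrite /quotient scalerA divfK ?gt_eqF// le_eqVlt; apply/orP; left; apply/eqP.
by field; rewrite !gt_eqF.
Qed.

Let slope_pZ a v : 0 < a -> D (a *: v) = a * D v.
Proof.
move=> a0; apply/eqP; rewrite eq_le slopeZ_le//= mulrC -ler_pdivlMr//.
have := @slopeZ_le a^-1 (a *: v); rewrite invr_gt0 => /(_ a0).
by rewrite scalerK ?gt_eqF// mulrC.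
Qed.

Variables (w : R -> R) (A : R).
Hypothesis hw : modulus_of_continuity w.
Hypothesis F_smooth : forall v,
  F (x + v) + F (x - v) <= 2 * F x + A * (enorm v * w (enorm v)).
Hypothesis A0 : 0 <= A.

(** Subadditivity gives [D v + D (- v) >= 0]. Conversely, the quotients of [v] and [- v] at step [t]
    sum to at most [A |v| w (t |v|)], which tends to 0. *)
Let slopeN v : D (- v) = - D v.
Proof.
have D0 : D 0 = 0.
  have := @slope_pZ 2 0 ltac:(by []); rewrite scaler0; lra.
have DN_ge : 0 <= D v + D (- v) by have := slopeD v (- v); rewrite subrr D0.
suff : D v + D (- v) <= 0 by lra.
have [->|v0] := eqVneq v 0; first by rewrite oppr0 D0 addr0.
have ev0 := enorm_gt0 v0.
apply/ler_addgt0Pr => e e0; rewrite add0r.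
have c0 : 0 < A * enorm v + 1 by rewrite ltr_wpDl// mulr_ge0// enorm_ge0.
have [d d0 hd] := modulus_small hw (divr_gt0 e0 c0).
pose t := d / 2 / enorm v; have t0 : 0 < t by rewrite !divr_gt0.
have tvE : enorm (t *: v) = d / 2.
  by rewrite enormZ gtr0_norm// /t divfK// gt_eqF.
have wd : w (d / 2) < e / (A * enorm v + 1) by apply: hd; lra.
apply: (@le_trans _ _ (quotient v t + quotient (- v) t)).
  by rewrite lerD// slope_le.
rewrite /quotient -mulrDl ler_pdivrMr//.
have := F_smooth (t *: v); rewrite tvE scalerN.
have wd0 : 0 <= w (d / 2) by rewrite modulus_ge0// divr_ge0// ltW.
rewrite ltr_pdivlMr// in wd; move: wd wd0; set W := w (d / 2) => wd wd0.
have -> : d / 2 = t * enorm v by rewrite /t divfK// gt_eqF.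
have := ler_wpM2l (ltW t0) (ltW wd); have := mulr_ge0 (ltW t0) wd0; lra.
Qed.

(** An odd sublinear function is linear: subadditivity at [- u] and [- v] gives the reverse
    inequality, and oddness covers [a < 0]. *)
Let slope_linear a u v : D (a *: u + v) = a * D u + D v.
Proof.
have DD : D (a *: u + v) = D (a *: u) + D v.
  apply/eqP; rewrite eq_le slopeD/=.
  have := slopeD (- (a *: u)) (- v); rewrite -opprD !slopeN; lra.
rewrite DD; congr (_ + _).
have [a0|a0|->] := ltgtP a 0; last 2 first.
- exact: slope_pZ.
- by rewrite scale0r mul0r; have := slopeN 0; rewrite oppr0; lra.
by rewrite -[a]opprK scaleNr slopeN slope_pZ ?oppr_gt0// !mulNr.
Qed.

Lemma convex_smooth_gradient : exists p, forall v,
  0 <= F (x + v) - F x - inner p v <= A * (enorm v * w (enorm v)).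
Proof.
(* The gradient is the vector representing the linear map [D]. The quotient at step 1 gives the
   lower bound; the same bound at [- v] together with [F_smooth] gives the upper one. *)
exists (\row_i D (delta_mx ord0 i)) => v.
have -> : inner (\row_i D (delta_mx ord0 i)) v = D v.
  rewrite {2}[v]row_sum_delta /inner.
  elim: (index_enum _) => [|i s ih].
    by rewrite !big_nil; have := slope_linear 1 0 0; rewrite scale1r addr0; lra.
  by rewrite !big_cons slope_linear ih mxE mulrC.
have Dle u : D u <= F (x + u) - F x.
  by have := @slope_le u 1 ltr01; rewrite /quotient scale1r divr1.
rewrite subr_ge0 Dle/=; have := Dle (- v); rewrite slopeN.
have := F_smooth v; lra.
Qed.

End slope.

End convex.

(** * Gradients, tangent planes and first-order remainders *)

Section gradient.
Context {R : realType} {n : nat}.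
Implicit Types (F : 'rV[R]_n -> R) (x y z u v p q : 'rV[R]_n).

Lemma inner_is_linear p : linear (inner p : 'rV[R]_n -> R^o).
Proof. by move=> a u v; rewrite innerDr innerZr. Qed.

HB.instance Definition _ p :=
  GRing.isLinear.Build R 'rV[R]_n R^o _ (inner p) (inner_is_linear p).

Lemma inner_delta p i : inner p (delta_mx ord0 i) = p ord0 i.
Proof.
rewrite /inner (bigD1 i)//= mxE !eqxx mulr1 big1 ?addr0// => j ji.
by rewrite mxE (negbTE ji) andbF mulr0.
Qed.

Lemma grad_inner F x v : differentiable F x -> 'd F x v = inner (grad F x) v.
Proof.
move=> dF; rewrite {1}[v]row_sum_delta linear_sum/=.
by apply: eq_bigr => i _; rewrite linearZ/= mxE deriveE// mulrC.
Qed.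

Variable w : R -> R.
Hypothesis hw : modulus_of_continuity w.

Lemma gradP F x p c : 0 <= c ->
  (forall v, `|F (x + v) - F x - inner p v| <= c * (enorm v * w (enorm v))) ->
  differentiable F x /\ grad F x = p.
Proof.
move=> c0 hF.
have dF : F \o shift x = cst (F x) + inner p +o_ (0 : 'rV[R]_n) id.
  apply/eqaddoP => e e0.
  (* The little-o is measured in the sup norm, which costs the factor [n.+1]. *)
  have c1 : 0 < c * n.+1%:R + 1 by rewrite ltr_wpDl// mulr_ge0.
  have [d d0 hd] := modulus_small hw (divr_gt0 e0 c1).
  apply: (nbhs_enorm d0) => v; rewrite sub0r enormN => vd.
  rewrite [leLHS](_ : _ = `|F (x + v) - F x - inner p v|); last first.
    congr `|_|; rewrite -[LHS]/(F (v + x) - (F x + inner p v)).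
    by rewrite opprD addrA [v + x]addrC.
  apply: le_trans (hF v) _; have [->|v0] := eqVneq v 0.
    by rewrite enorm0 mul0r mulr0 mulr_ge0// ltW.
  have ev0 := enorm_gt0 v0; have := hd _ ev0 vd.
  rewrite ltr_pdivlMr// => wv; have wv0 := modulus_ge0 hw (ltW ev0).
  rewrite /=; have := enorm_le_norm v; set m := `|v| => vm.
  have m0 : 0 <= m by apply: normr_ge0.
  apply: (@le_trans _ _ (c * (n.+1%:R * m * w (enorm v)))).
    by rewrite ler_wpM2l// ler_wpM2r.
  have := ler_wpM2l m0 (ltW wv); have := mulr_ge0 m0 wv0; lra.
have dE := diff_unique (@inner_continuous _ _ p) dF.
have diffF : differentiable F x.
  by apply/diff_locallyP; rewrite dE; split=> //; exact: inner_continuous.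
split=> //; apply/rowP => i.
by rewrite mxE deriveE// dE; exact: inner_delta.
Qed.

(** Convexity bounds the quotient at a step [t <= 1] by [F (x + v) - F x], and for small [t] it is
    within [e] of the derivative. *)
Lemma convex_grad_le F x v : convex_on_space F -> differentiable F x ->
  inner (grad F x) v <= F (x + v) - F x.
Proof.
move=> cF dF; rewrite -grad_inner//; have /eqaddoP ho := diff_locally dF.
apply/ler_addgt0Pr => e e0; have c0 : 0 < `|v| + 1 by rewrite ltr_wpDl.
have /nbhs_ballP[d /= d0 hd] := ho _ (divr_gt0 e0 c0).
pose t := Num.min 1 (d / 2 / (`|v| + 1)).
have t0 : 0 < t by rewrite lt_min ltr01 !divr_gt0.
have t1 : t <= 1 by rewrite ge_min lexx.
have tv : `|t *: v| < d.
  rewrite normrZ gtr0_norm//; apply: (@le_lt_trans _ _ (d / 2)); last by lra.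
  apply: (@le_trans _ _ (t * (`|v| + 1))).
    by rewrite ler_wpM2l ?lerDl// ltW.
  by rewrite -ler_pdivlMr// ge_min lexx orbT.
have /hd : ball (0 : 'rV[R]_n) d (t *: v).
  by rewrite mx_norm_ball /ball_/= sub0r normrN.
rewrite -[X in `|X|]/(F (t *: v + x) - (F x + 'd F x (t *: v))) linearZ/=.
rewrite normrZ gtr0_norm// ler_norml => /andP[+ _].
have /convex_on_spaceP/(_ t (x + v) x (ltW t0) t1) := cF.
rewrite scalerDr addrAC -scalerDl subrKC scale1r (addrC x).
set Fv := F (x + v); set D := 'd F x v; set Ft := F _.
have -> : t *: (D : R^o) = t * D by [].
have ev : e / (`|v| + 1) * `|v| <= e.
  by rewrite mulrAC ler_pdivrMr// ler_wpM2l ?lerDl// ltW.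
have := ler_wpM2l (ltW t0) ev; move=> h1 h2 h3; rewrite -(ler_pM2l t0); lra.
Qed.

(** The upper bound at [y] and the tangent plane at [x] are compared at [x + v], with [v] of length
    [d = |x - y|] along the difference [a] of the gradients; the tangent plane at [y] bounds [F x]
    from below. As [x + v] is within [2 d] of [y], this gives [d |a| <= c (2 d) (2 w d)]. *)
Lemma smooth_convex_grad_lipschitz F x y c : 0 <= c ->
  convex_on_space F -> differentiable F x ->
  (forall v, F (y + v) - F y - inner (grad F y) v <=
    c * (enorm v * w (enorm v))) ->
  (forall v, inner (grad F y) v <= F (y + v) - F y) ->
  enorm (grad F x - grad F y) <= 4 * c * w (enorm (x - y)).
Proof.
move=> c0 cF dF hi lo; set a := grad F x - grad F y; set d := enorm (x - y).
have [a_eq0|a_neq0] := eqVneq a 0.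
  rewrite a_eq0 enorm0; apply: mulr_ge0; first by rewrite mulr_ge0.
  by rewrite modulus_ge0// enorm_ge0.
have [xy|xy] := eqVneq (x - y) 0.
  by move: a_neq0; rewrite /a (subr0_eq xy) subrr eqxx.
have a0 := enorm_gt0 a_neq0; have d0 : 0 < d := enorm_gt0 xy.
have wd0 := modulus_ge0 hw (ltW d0).
pose b := d / enorm a; have b0 : 0 < b by rewrite divr_gt0.
have bd : enorm (b *: a) = d by rewrite enormZ gtr0_norm// /b divfK// gt_eqF.
set v := b *: a in bd.
have Fz : inner (grad F x) v <= F (x + v) - F x by exact: convex_grad_le.
have Fx := lo (x - y); rewrite subrKC in Fx.
have := hi (x - y + v); rewrite [y + _]addrA subrKC.
have zd : enorm (x - y + v) <= 2 * d.
  by apply: le_trans (enormD _ _) _; rewrite bd -/d; lra.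
have wz : w (enorm (x - y + v)) <= 2 * w d.
  apply: le_trans (_ : w (2 * d) <= _).
    exact: modulus_le (enorm_ge0 _) zd.
  by apply: modulus_dilate => //; [lra|exact: ltW].
have zz : enorm (x - y + v) * w (enorm (x - y + v)) <= 2 * d * (2 * w d).
  by apply: ler_pM => //; [|apply: (modulus_ge0 hw)]; exact: enorm_ge0.
move=> /le_trans/(_ (ler_wpM2l c0 zz)); rewrite innerDr => hz.
have av : inner a v = d * enorm a.
  by rewrite /v innerZr -enorm_sqr /b; field; rewrite gt_eqF.
have avE : inner a v = inner (grad F x) v - inner (grad F y) v.
  by rewrite /a innerDl innerNl.
rewrite -(ler_pM2l d0) -av avE; lra.
Qed.

(** The tangent plane at [x], evaluated at [y], reduces this to a bound on
    [<grad F x - grad F y, x - y>]; convexity takes the place of integration along the segment. *)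
Lemma expansion_of_lipschitz_grad F x y c :
  convex_on_space F -> differentiable F y ->
  (forall z, enorm (grad F z - grad F y) <= c * w (enorm (z - y))) ->
  differentiable F x ->
  F x - F y - inner (grad F y) (x - y) <=
    c * (enorm (x - y) * w (enorm (x - y))).
Proof.
move=> cF dF hc dFx.
have := @convex_grad_le F x (y - x) cF dFx.
rewrite subrKC => h.
have := cauchy_schwarz (grad F x - grad F y) (x - y).
have := ler_wpM2r (enorm_ge0 (x - y)) (hc x).
rewrite innerDl innerNl; move: h; rewrite -opprB innerNr; lra.
Qed.

End gradient.

(** * The largest convex function below a family *)

Section envelope.
Context {R : realType} {n : nat} (T : Type).
Variables (D : set T) (g : T -> 'rV[R]_n -> R) (h0 : 'rV[R]_n -> R).
Implicit Types (x v : 'rV[R]_n).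

Let below := [set h | convex_on_space h /\ forall t x, D t -> h x <= g t x].

Definition convex_envelope x := sup [set h x | h in below].

Hypothesis D_neq0 : D !=set0.
Hypothesis h0_below : convex_on_space h0 /\ forall t x, D t -> h0 x <= g t x.

(** The supremum is genuine: [h0] makes the set nonempty, and one [g t] with [t] in [D] bounds
    it. *)
Let has_sup_below x : has_sup [set h x | h in below].
Proof.
split; first by exists (h0 x), h0.
by case: D_neq0 => t Dt; exists (g t x) => _ [h [_ hg] <-]; exact: hg.
Qed.

Lemma convex_envelope_ge h x : convex_on_space h ->
  (forall t x, D t -> h x <= g t x) -> h x <= convex_envelope x.
Proof.
by move=> ch hg; apply: sup_upper_bound; [exact: has_sup_below|exists h].
Qed.

Let envelope_le x c : (forall h, below h -> h x <= c) -> convex_envelope x <= c.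
Proof.
move=> hc; apply: ge_sup => [|_ [h hb <-]]; last exact: hc.
by have [] := has_sup_below x.
Qed.

Lemma convex_envelope_le t x : D t -> convex_envelope x <= g t x.
Proof. by move=> Dt; apply: envelope_le => h [_]; exact. Qed.

Lemma convex_envelope_convex : convex_on_space convex_envelope.
Proof.
apply/convex_on_spaceP => a x y a0 a1; apply: envelope_le => h [ch hg].
have /convex_on_spaceP/(_ a x y a0 a1)/le_trans := ch; apply.
by rewrite lerD// ler_wpM2l ?subr_ge0// convex_envelope_ge.
Qed.

Lemma convex_envelope_second_difference v b :
  (forall t x, D t -> g t (x + v) + g t (x - v) <= 2 * g t x + b) ->
  forall x, convex_envelope (x + v) + convex_envelope (x - v) <=
    2 * convex_envelope x + b.
Proof.
move=> gb x; rewrite -lerBrDr; apply: envelope_le => h1 [ch1 hg1].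
rewrite lerBrDr -lerBrDl; apply: envelope_le => h2 [ch2 hg2].
rewrite lerBrDl -lerBlDr.
(* [h1] and [h2] are independent convex minorants, one for each translate; the hypothesis [gb] at
   [y] keeps [h] below [g t]. *)
pose h (y : 'rV[R]_n) := (h1 (y + v) + h2 (y - v) - b) / 2.
have -> : h1 (x + v) + h2 (x - v) - b = 2 * h x by rewrite /h; field.
rewrite ler_pM2l//; apply: convex_envelope_ge => [|t y Dt].
  apply/convex_on_spaceP => a y z a0 a1; rewrite /h.
  have shift u : a *: y + (1 - a) *: z + u = a *: (y + u) + (1 - a) *: (z + u).
    by rewrite !scalerDr addrACA -scalerDl subrKC scale1r.
  rewrite !shift.
  have /convex_on_spaceP/(_ a (y + v) (z + v) a0 a1) := ch1.
  have /convex_on_spaceP/(_ a (y - v) (z - v) a0 a1) := ch2; lra.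
have := gb t y Dt; have := hg1 t (y + v) Dt; have := hg2 t (y - v) Dt.
rewrite /h; lra.
Qed.

End envelope.

(** * Affine functions given by the data on [C] *)

Section affine.
Context {R : realType} {n : nat}.
Implicit Types (f : 'rV[R]_n -> R) (G : 'rV[R]_n -> 'rV[R]_n).

Lemma affine_convex (c : R) (p y : 'rV[R]_n) :
  convex_on_space (fun x => c + inner p (x - y)).
Proof.
apply/convex_on_spaceP => a x z _ _.
rewrite le_eqVlt; apply/orP; left; apply/eqP; rewrite !innerE; ring.
Qed.

Variable w : R -> R.
Hypothesis hw : modulus_of_continuity w.

Lemma modulus_inv_admissible f G C M x y : admissible w f G C M -> C x -> C y ->
  exists s, [/\ 0 <= s, w s = (2 * M)^-1 * enorm (G x - G y) &
    enorm (G x - G y) * s <= f x - f y - inner (G y) (x - y)].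
Proof.
move=> [M0 lip cw] Cx Cy; have d0 := enorm_ge0 (x - y).
have a0 := enorm_ge0 (G x - G y); have wd0 := modulus_ge0 hw d0.
have M20 : 0 < 2 * M by rewrite mulr_gt0.
have v0 : 0 <= (2 * M)^-1 * enorm (G x - G y).
  by rewrite mulr_ge0// invr_ge0 ltW.
have vd : (2 * M)^-1 * enorm (G x - G y) <= w (enorm (x - y)).
  rewrite mulrC ler_pdivrMr//; have := lip x y Cx Cy.
  have := mulr_ge0 (ltW M0) wd0; lra.
have [s s0 ws] := modulus_surj hw d0 v0 vd.
exists s; split=> //; have := cw x y Cx Cy.
by rewrite -ws modulus_invK.
Qed.

(* Young's inequality for [s |-> w s] and its inverse: with [a] the distance of
   the slopes, [w s = a / (2 M)] and [d = |x - y|], either [d <= s] and the gap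
   [a s] in the data dominates [a d], or [a d = a s + 2 M w s (d - s)]. *)
Lemma affine_minorant f G C M x y z : admissible w f G C M -> C y -> C z ->
  f z + inner (G z) (x - z) <= f y + inner (G y) (x - y) +
    2 * M * (enorm (x - y) * w (enorm (x - y))).
Proof.
move=> adm Cy Cz; have [s [s0 ws hs]] := modulus_inv_admissible adm Cy Cz.
have [M0 _ _] := adm; move: ws hs.
have -> : y - z = (x - z) - (x - y) by rewrite opprB [RHS]addrC subrKA.
set a := enorm _; set d := enorm (x - y) => ws hs.
have d0 : 0 <= d := enorm_ge0 _; have a0 : 0 <= a := enorm_ge0 _.
have wd0 := modulus_ge0 hw d0.
have aE : a = 2 * M * w s by rewrite ws mulVKf// mulf_neq0// gt_eqF.
have := cauchy_schwarz (G z - G y) (x - y).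
rewrite enormB -/a -/d innerDl innerNl.
move: hs; rewrite innerDr innerNr => h1 h2.
suff : a * d <= a * s + 2 * M * (d * w d) by lra.
have [ds|sd] := leP d s.
  have := ler_wpM2l a0 ds; have := mulr_ge0 (ltW M0) (mulr_ge0 d0 wd0); lra.
have ws0 := modulus_ge0 hw s0.
have wsd := modulus_le hw s0 (ltW sd).
have h3 := ler_wpM2l d0 wsd; have h4 := mulr_ge0 s0 ws0.
have := ler_wpM2l (ltW M0) h3; have := mulr_ge0 (ltW M0) h4.
rewrite aE; lra.
Qed.

End affine.

(** * Building the extension, and the converse *)

Section extension.
Context {R : realType} {n : nat}.
Variable w : R -> R.
Hypothesis hw : modulus_of_continuity w.
Implicit Types (f F : 'rV[R]_n -> R) (G : 'rV[R]_n -> 'rV[R]_n).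
Implicit Types (C : set 'rV[R]_n).

Lemma grad_continuous F L : 0 <= L ->
  (forall x y, enorm (grad F x - grad F y) <= L * w (enorm (x - y))) ->
  continuous (grad F).
Proof.
move=> L0 hL x; apply/(@cvgrPdist_lt _ _ _ (nbhs x)) => e e0.
have c0 : 0 < L + 1 by rewrite ltr_wpDl.
have [d d0 hd] := modulus_small hw (divr_gt0 e0 c0).
apply: (nbhs_enorm d0) => y xy.
apply: le_lt_trans (norm_le_enorm _) _.
have [->|xy0] := eqVneq x y; first by rewrite subrr enorm0.
apply: le_lt_trans (hL x y) _.
have exy0 : 0 < enorm (x - y) by rewrite enorm_gt0// subr_eq0.
have := hd _ exy0 xy; rewrite ltr_pdivlMr//.
have := modulus_ge0 hw (ltW exy0); lra.
Qed.

Lemma admissible_extension f G C M : C !=set0 -> admissible w f G C M ->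
  exists F, [/\ convex_on_space F, C1w w F,
    (forall x, C x -> F x = f x), (forall x, C x -> grad F x = G x) &
    forall x y, enorm (grad F x - grad F y) <= 48 * M * w (enorm (x - y))].
Proof.
move=> C0 adm; have [M0 _ _] := adm.
pose l y x := f y + inner (G y) (x - y).
pose g y x := l y x + 2 * M * (enorm (x - y) * w (enorm (x - y))).
have lg z : C z -> forall y x, C y -> l z x <= g y x.
  by move=> Cz y x Cy; exact: (affine_minorant hw x adm Cy Cz).
have [y0 Cy0] := C0.
have l_below : convex_on_space (l y0) /\ forall y x, C y -> l y0 x <= g y x.
  by split; [exact: affine_convex|exact: lg].
pose F := convex_envelope C g; exists F.
have cF : convex_on_space F by exact: (convex_envelope_convex C0 l_below).
have lF z x : C z -> l z x <= F x.
  move=> Cz; apply: (convex_envelope_ge C0 l_below); last exact: lg.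
  exact: affine_convex.
have Fg y x : C y -> F x <= g y x by exact: (convex_envelope_le C0 l_below).
(* The affine parts have zero second difference, so the constant is 6 times [2 M]. *)
have F_smooth x v :
    F (x + v) + F (x - v) <= 2 * F x + 12 * M * (enorm v * w (enorm v)).
  apply: (convex_envelope_second_difference C0 l_below) => y {}x Cy.
  rewrite /g /l !(addrAC x _ (- y)) !innerDr innerNr.
  have := ler_wpM2l (ltW M0) (radial_second_difference hw (x - y) v); lra.
have M12 : 0 <= 12 * M by rewrite mulr_ge0// ltW.
have diffF x : differentiable F x /\ forall v,
    0 <= F (x + v) - F x - inner (grad F x) v <=
    12 * M * (enorm v * w (enorm v)).
  have [p hp] := convex_smooth_gradient cF hw (F_smooth x) M12.
  have [|dF gF] := gradP hw (F := F) (x := x) (p := p) M12.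
    by move=> v; have /andP[v0 v1] := hp v; rewrite ger0_norm.
  by rewrite gF.
have lipF x y : enorm (grad F x - grad F y) <= 48 * M * w (enorm (x - y)).
  have [dF _] := diffF x; have [_ hy] := diffF y.
  have -> : 48 * M = 4 * (12 * M) by ring.
  apply: (smooth_convex_grad_lipschitz hw M12 cF dF) => v.
    by have /andP[] := hy v.
  by have /andP[+ _] := hy v; rewrite subr_ge0.
have Ff x : C x -> F x = f x.
  move=> Cx; apply/eqP; rewrite eq_le.
  have := Fg x x Cx; have := lF x x Cx.
  by rewrite /g /l subrr innerC inner0l enorm0 mul0r mulr0 !addr0 => -> ->.
have M48 : 0 <= 48 * M by rewrite mulr_ge0// ltW.
split=> //.
  split; last by exists (48 * M).
  by split=> [x|]; [have [] := diffF x|exact: grad_continuous M48 lipF].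
(* At a point of [C], the tangent plane [l x] and the function [g x] enclose [F] and differ by
   [2 M |v| w |v|], so [gradP] identifies the gradient. *)
move=> x Cx; have M2 : 0 <= 2 * M by rewrite mulr_ge0// ltW.
suff : forall v, `|F (x + v) - F x - inner (G x) v| <=
    2 * M * (enorm v * w (enorm v)) by move=> /(gradP hw M2)[].
move=> v; have := Fg x (x + v) Cx; have := lF x (x + v) Cx.
rewrite /g /l (addrC x) addrK (addrC v) (Ff x Cx) => h1 h2.
by rewrite ger0_norm; lra.
Qed.

(* The gradient inequality at [y] is tested at [x + v] with [v] in the direction
   of the difference of the gradients and of length twice the value of the
   inverse modulus. *)
Lemma extension_admissible F f G C : convex_on_space F -> C1w w F ->
  (forall x, C x -> F x = f x) -> (forall x, C x -> grad F x = G x) ->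
  exists M, admissible w f G C M.
Proof.
move=> cF [[dF _] [L L0 hL]] Ff FG; pose c := L + 1.
have c0 : 0 < c by rewrite ltr_wpDl.
have hc x y : enorm (grad F x - grad F y) <= c * w (enorm (x - y)).
  apply: le_trans (hL x y) _.
  by rewrite ler_wpM2r ?lerDl// (modulus_ge0 hw) ?enorm_ge0.
(* With [M = 2 c] the preimage [r] satisfies [a = 4 c w r]. A test vector of length [2 r] gains
   [2 r a] and loses at most [c (2 r) w (2 r) <= 4 c r w r = r a], which leaves the required
   [r a]. *)
exists (2 * c); split; first by rewrite mulr_gt0.
  move=> x y Cx Cy; rewrite -!FG//; apply: le_trans (hc x y) _.
  by rewrite ler_wpM2r ?(modulus_ge0 hw) ?enorm_ge0//; lra.
move=> x y Cx Cy; rewrite -!FG// -!Ff//.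
have := convex_grad_le (x - y) cF (dF y); rewrite subrKC => Fxy.
set a := enorm _; have [a_eq0|a_neq0] := eqVneq a 0.
  by rewrite a_eq0 mul0r; lra.
have a0 : 0 < a by rewrite lt_neqAle eq_sym a_neq0 enorm_ge0.
have d0 := enorm_ge0 (x - y); have wd0 := modulus_ge0 hw d0.
have c40 : 0 < 2 * (2 * c) by rewrite !mulr_gt0.
have r_ge0 : 0 <= (2 * (2 * c))^-1 * a.
  by apply: mulr_ge0; rewrite ?invr_ge0 ltW.
have r_le : (2 * (2 * c))^-1 * a <= w (enorm (x - y)).
  rewrite mulrC ler_pdivrMr//; have := hc x y; rewrite -/a.
  have := mulr_ge0 (ltW c0) wd0; lra.
have [r r0 wr] := modulus_surj hw d0 r_ge0 r_le.
rewrite -wr modulus_invK//.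
have aE : a = 4 * c * w r by rewrite wr; field; rewrite gt_eqF.
pose b := 2 * r / a; pose v := b *: (grad F y - grad F x).
have b0 : 0 <= b by rewrite divr_ge0 ?mulr_ge0// ltW.
have ev : enorm v = 2 * r.
  by rewrite enormZ ger0_norm// enormB -/a /b divfK.
have vE : inner (grad F y) v - inner (grad F x) v = 2 * r * a.
  by rewrite -innerNl -innerDl innerZr -enorm_sqr enormB -/a /b; field.
have w2r : w (2 * r) <= 2 * w r by apply: (modulus_dilate hw) => //; lra.
have := convex_grad_le (x - y + v) cF (dF y).
rewrite [y + _]addrA subrKC innerDr.
have := expansion_of_lipschitz_grad cF (dF x) (hc^~ x) (dF (x + v)).
rewrite [x + v]addrC addrK ev => h1 h2.
have := ler_wpM2l (mulr_ge0 (ltW c0) (mulr_ge0 (ler0n R 2) r0)) w2r.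
move: vE; rewrite aE; lra.
Qed.

Lemma grad_seminorm_le F K :
  (forall x y, enorm (grad F x - grad F y) <= K * w (enorm (x - y))) ->
  (grad_seminorm w F <= K%:E)%E.
Proof.
move=> hK; apply: ge_ereal_sup => _ [x [y [/eqP xy ->]]].
have d0 : 0 < enorm (x - y) by rewrite enorm_gt0// subr_eq0.
rewrite lee_fin ler_pdivrMr//; apply: le_lt_trans (modulus_lt hw (lexx 0) d0).
exact: (modulus_ge0 hw).
Qed.

End extension.

Local Open Scope ereal_scope.

Theorem theorem1p5 (R : realType) (n : nat) :
  exists k : R, (0 < k)%R /\
  forall (w : R -> R) (C : set 'rV[R]_n)
    (f : 'rV[R]_n -> R) (G : 'rV[R]_n -> 'rV[R]_n),
  modulus_of_continuity w ->
  nonconstant_on C G ->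
  ((exists F : 'rV[R]_n -> R,
      [/\ convex_on_space F, C1w w F,
          (forall x, C x -> F x = f x) &
          (forall x, C x -> grad F x = G x)])
   <-> Mstar w f G C < +oo) /\
  (Mstar w f G C < +oo ->
   exists F : 'rV[R]_n -> R,
     [/\ convex_on_space F, C1w w F,
         (forall x, C x -> F x = f x) &
         (forall x, C x -> grad F x = G x)] /\
     grad_seminorm w F <= k%:E * Mstar w f G C /\
     (C 0%R -> norm1w w F <=
        k%:E * ((`|f 0%R|)%:E + (enorm (G 0%R))%:E + Mstar w f G C))).
Proof.
exists 48%R; split=> [//|w C f G hw ncG].
have [x0 [_ [Cx0 _ _]]] := ncG.
have C0 : (C !=set0)%classic by exists x0.
have extend : Mstar w f G C < +oo ->
   exists F : 'rV[R]_n -> R,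
     [/\ convex_on_space F, C1w w F,
         (forall x, C x -> F x = f x) &
         (forall x, C x -> grad F x = G x)] /\
     grad_seminorm w F <= 48%:E * Mstar w f G C /\
     (C 0%R -> norm1w w F <=
        48%:E * ((`|f 0%R|)%:E + (enorm (G 0%R))%:E + Mstar w f G C)).
  (* The infimum is attained, so the extension is built from [Mstar] itself. *)
  move=> /(Mstar_min hw ncG)[M [-> adm _]].
  have [F [cF F1 Ff FG lipF]] := admissible_extension hw C0 adm.
  have semiF := grad_seminorm_le hw lipF.
  exists F; split; [by []|split; first by rewrite -EFinM].
  (* [F 0] and [grad F 0] are the data at 0, so these two terms need only [1 <= 48]. *)
  move=> C00; rewrite /norm1w Ff// FG//.
  apply: le_trans (leeD2l _ semiF) _; rewrite -!EFinD -EFinM lee_fin.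
  have := enorm_ge0 (G 0%R); have := normr_ge0 (f 0%R); lra.
split=> //; split=> [[F [cF F1 Ff FG]]|/extend[F [? _]]]; last by exists F.
have [M adm] := extension_admissible hw cF F1 Ff FG.
apply: le_lt_trans (ltry M); apply: ereal_inf_lbound.
by exists M.
Qed.
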